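(* Let $S\subset\mathbb{R}^n$, $f:S\to\mathbb{R}$, let $S'\subset\mathbb{R}^n$, and let $\varphi:S\to S'$ be a homeomorphism. Then $f\in\mathcal{G}(S)$ if and only if $f\circ\varphi^{-1}\in\mathcal{G}(S')$.
   Context: For $S\subset\mathbb{R}^n$ and $g:S\to\mathbb{R}$: a point $x\in S$ is a global minimum of $g$ if $g(x)\le g(y)$ for all $y\in S\setminus\{x\}$; it is a local minimum of $g$ if there exists $\epsilon>0$ such that $g(x)\le g(y)$ for all $y\in S\setminus\{x\}$ with $\|x-y\|_2\le\epsilon$ ($\|\cdot\|_2$ the Euclidean norm). The function $g$ is a global function on $S$ if it is continuous and all its local minima are global minima. $\mathcal{G}(S)$ denotes the set of all global functions on $S$. Subsets of $\mathbb{R}^n$ carry the subspace topology. *)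

(* Defs.v *)
From HB Require Import structures.
From mathcomp Require Import all_boot all_order all_algebra.
From mathcomp Require Import all_classical all_reals all_analysis.
Import Order.TTheory GRing.Theory Num.Theory.
Import numFieldNormedType.Exports.

Set Implicit Arguments.
Unset Strict Implicit.
Unset Printing Implicit Defensive.

Local Open Scope classical_set_scope.
Local Open Scope ring_scope.

(* R^n is 'rV[R]_n, whose library topology is the product (usual) topology.
   The library norm `|x| on 'rV[R]_n is the sup norm, so the Euclidean norm is
   defined separately. *)
Definition euclidean_norm (R : realType) (n : nat) (x : 'rV[R]_n) : R :=
  Num.sqrt (\sum_(i < n) x ord0 i ^+ 2).

(* A subset S : set 'rV[R]_n used as a type is the sigma type of its elements
   (coercion set_type), with inclusion set_val; the library equips it with the
   initial topology for set_val, i.e., the subspace topology. *)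

Section GlobalFunctions.
Context {R : realType} {n : nat}.

Definition global_minimum (S : set 'rV[R]_n) (g : S -> R) (x : S) : Prop :=
  forall y : S, y <> x -> g x <= g y.

Definition local_minimum (S : set 'rV[R]_n) (g : S -> R) (x : S) : Prop :=
  exists2 eps : R, 0 < eps &
    forall y : S, y <> x ->
      euclidean_norm (set_val x - set_val y) <= eps -> g x <= g y.

Definition global_functions (S : set 'rV[R]_n) : set (S -> R) :=
  [set g | continuous g /\
           forall x : S, local_minimum g x -> global_minimum g x].

End GlobalFunctions.

Arguments global_functions {R n} S.

Record homeomorphism (X Y : topologicalType) := Homeomorphism {
  homeo_fun :> X -> Y;
  homeo_inv : Y -> X;
  homeo_funK : cancel homeo_fun homeo_inv;
  homeo_invK : cancel homeo_inv homeo_fun;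
  homeo_fun_continuous : continuous homeo_fun;
  homeo_inv_continuous : continuous homeo_inv }.

(* Main.v *)
Require Import Defs.
From mathcomp Require Import all_boot all_order all_algebra.
From mathcomp Require Import all_classical all_reals all_analysis.
Import numFieldNormedType.Exports.
Import Order.TTheory GRing.Theory Num.Theory.

(** Being a local minimum is a purely topological property: although it is
    defined with Euclidean balls, it says exactly that [g x <= g y] for all [y]
    in some neighbourhood of [x] in [S] ([local_minimum_nearE]), because the
    Euclidean norm and the sup norm, whose balls generate the topology of
    ['rV_n], dominate each other up to a constant ([euclidean_norm_lt_ball],
    [ball_euclidean_norm_le]).  Continuity is topological too, and being a
    global minimum only depends on the values of the function.  Hence
    precomposition with the inverse of a homeomorphism carries all three
    notions over ([global_functions_homeo]), and the converse implication is
    the same fact for the inverse homeomorphism. *)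

Section GlobalFunctionsHomeo.

Set Implicit Arguments.
Unset Strict Implicit.

Local Open Scope classical_set_scope.
Local Open Scope ring_scope.

Context {R : realType} {n : nat}.
Implicit Types (x y : 'rV[R]_n) (S : set 'rV[R]_n).

Lemma euclidean_norm_lt_ball x y (e : R) :
  0 < e -> euclidean_norm (x - y) < e -> ball x e y.
Proof.
move=> e0 xye; split => // i j; rewrite ord1 -ball_normE /=.
apply: le_lt_trans xye; rewrite /euclidean_norm -sqrtr_sqr.
rewrite ler_wsqrtr// (bigD1 j)//= !mxE lerDl.
by apply: sumr_ge0 => k _; rewrite sqr_ge0.
Qed.

(** Each of the [n] squares in the sum is at most [d ^+ 2] on the ball of radius
    [d], so any [d > 0] with [n * d ^+ 2 <= e ^+ 2] would do; dividing by [n.+1]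
    instead of [n] keeps the radius positive when [n = 0]. *)
Lemma ball_euclidean_norm_le x y (e : R) :
  0 < e -> ball x (e / n.+1%:R) y -> euclidean_norm (x - y) <= e.
Proof.
move=> e0 [d0 xyd]; rewrite /euclidean_norm -[leRHS](ger0_norm (ltW e0)).
rewrite -sqrtr_sqr ler_wsqrtr//.
apply: (@le_trans _ _ (\sum_(i < n) (e / n.+1%:R) ^+ 2)).
  apply: ler_sum => j _; have := xyd ord0 j; rewrite -ball_normE /= !mxE.
  by move=> /ltW xyj; rewrite -real_normK ?num_real// lerXn2r ?nnegrE// ltW.
rewrite sumr_const card_ord expr_div_n -[leLHS]mulr_natr -mulrA.
rewrite ler_piMr ?sqr_ge0// mulrC ler_pdivrMr ?exprn_gt0// mul1r.
by rewrite -natrX ler_nat (leq_trans (leqnSn n))// leq_pmulr.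
Qed.

(** The balls of the subspace [S] are the traces of the sup-norm balls of
    ['rV_n] ([initial_ballE]), so comparing the two norms is enough; this form
    of local minimality can be transported along continuous maps. *)
Lemma local_minimum_nearE S (g : S -> R) (x : S) :
  local_minimum g x <-> \forall y \near x, g x <= g y.
Proof.
split=> [[e e0 minx]|].
  apply/nbhs_ballP; exists (e / n.+1%:R) => /=; first by rewrite divr_gt0.
  move=> y; rewrite -initial_ballE => /(ball_euclidean_norm_le e0) xye.
  have [->//|/eqP yx] := eqVneq y x.
  exact: minx.
move=> /nbhs_ballP[e /= e0 minx].
(* Halving turns the closed Euclidean ball into a subset of an open one. *)
exists (e / 2); first by rewrite divr_gt0.
move=> y _ xye; apply: minx; rewrite -initial_ballE.
apply: euclidean_norm_lt_ball => //; apply: (le_lt_trans xye).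
by rewrite ltr_pdivrMr// ltr_pMr// ltr1n.
Qed.

(** A local minimum [x] of the transported function comes from a local minimum
    of [f] at the preimage of [x], which is global by hypothesis; continuity of
    the inverse serves for the continuity of the composite, that of [phi] for
    pulling the neighbourhood of [x] back to [S]. *)
Lemma global_functions_homeo S S' (phi : homeomorphism S S') (f : S -> R) :
  global_functions S f -> global_functions S' (f \o homeo_inv phi).
Proof.
move=> [fc fmin]; split=> [x|x /local_minimum_nearE minx y yx].
  by apply: continuous_comp; [exact: homeo_inv_continuous | exact: fc].
apply: fmin => [|eq_inv]; last first.
  by apply: yx; rewrite -[y](homeo_invK phi) eq_inv homeo_invK.
apply/local_minimum_nearE.
rewrite -{1}[x](homeo_invK phi) in minx.
have : \forall z \near homeo_inv phi x,
  f (homeo_inv phi x) <= f (homeo_inv phi (phi z)) := homeo_fun_continuous minx.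
by apply: filterS => z /=; rewrite homeo_funK.
Qed.

Definition homeomorphism_inverse {X Y : topologicalType}
    (phi : homeomorphism X Y) : homeomorphism Y X :=
  Homeomorphism (homeo_invK phi) (homeo_funK phi)
    (@homeo_inv_continuous _ _ phi) (@homeo_fun_continuous _ _ phi).

End GlobalFunctionsHomeo.

Theorem proposition2p2 (R : realType) (n : nat) (S : set 'rV[R]_n) (f : S -> R)
    (S' : set 'rV[R]_n) (phi : homeomorphism S S') :
  global_functions S f <-> global_functions S' (f \o homeo_inv phi).
Proof.
split; first exact: global_functions_homeo.
move=> /(global_functions_homeo (homeomorphism_inverse phi)).
congr global_functions; apply/funext => x /=.
by rewrite homeo_funK.
Qed.
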